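(* Let $\boldsymbol{\Psi}_p=[\boldsymbol{\Psi}_{p,0},\ldots,\boldsymbol{\Psi}_{p,L-1}]$ with $\boldsymbol{\Psi}_{p,\ell}=\mathbf{D}\,\mathrm{diag}(\mathbf{z}_{p,\ell})\boldsymbol{\Phi}\in\mathbb{C}^{N\times Q}$, let $\mathbf{R}_{pp}=\boldsymbol{\Psi}_p^H\boldsymbol{\Psi}_p\in\mathbb{C}^{QL\times QL}$ and $\mathbf{R}_{ij}=\boldsymbol{\Psi}_{p,i}^H\boldsymbol{\Psi}_{p,j}\in\mathbb{C}^{Q\times Q}$. (i) If the zero pilot--pilot leakage (ZPPL) condition $\boldsymbol{\Psi}_{p,i}^H\boldsymbol{\Psi}_{p,j}=\mathbf{0}$ for all $i\ne j$ holds, then $\mathbf{R}_{pp}=\mathrm{blkdiag}(\mathbf{R}_{00},\ldots,\mathbf{R}_{L-1,L-1})$; and if in addition each $\mathbf{R}_{\ell\ell}$ is nonsingular, then for every $\mathbf{r}\in\mathbb{C}^N$ the estimator $\hat{\boldsymbol{\gamma}}=\mathbf{R}_{pp}^{-1}\boldsymbol{\Psi}_p^H\mathbf{r}$ separates as $\hat{\boldsymbol{\gamma}}=[\hat{\boldsymbol{\gamma}}_0^T,\ldots,\hat{\boldsymbol{\gamma}}_{L-1}^T]^T$ with $\hat{\boldsymbol{\gamma}}_\ell=\mathbf{R}_{\ell\ell}^{-1}\boldsymbol{\Psi}_{p,\ell}^H\mathbf{r}$ for $\ell=0,\ldots,L-1$. (ii) $\mathbf{R}_{pp}$ is a diagonal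 matrix if and only if ZPPL holds and $$\sum_{n=0}^{N-1}|z_{p,\ell}[n]|^2\phi_a^*[n]\phi_b[n]=0\quad\text{for all }\ell\in\{0,\ldots,L-1\}\text{ and all }a\ne b\text{ in }\{0,\ldots,Q-1\}.$$
   Context: $N,L,Q$ are positive integers; $\mathbf{D}\in\mathbb{C}^{N\times N}$ is unitary; $\boldsymbol{\Phi}\in\mathbb{C}^{N\times Q}$ is the BEM basis matrix, whose columns are the basis functions $\phi_0,\ldots,\phi_{Q-1}$, with samples $\phi_q[n]$, $n=0,\ldots,N-1$; $\mathbf{z}_{p,\ell}=\mathbf{S}_\ell\mathbf{x}_p\in\mathbb{C}^N$, with entries $z_{p,\ell}[n]$, is the known transmitted pilot vector $\mathbf{x}_p\in\mathbb{C}^N$ shifted by the delay-shift operator $\mathbf{S}_\ell\in\mathbb{C}^{N\times N}$ of the guard in use. The guard modes are (indices in $\{0,\ldots,N-1\}$): cyclic prefix, $\mathbf{S}_\ell=\boldsymbol{\Pi}^\ell$ with $(\boldsymbol{\Pi}\mathbf{x})[n]=\mathbf{x}[(n-1)\bmod N]$; zero padding, $[\mathbf{S}_\ell]_{n,k}=1$ if $n=k+\ell$ and $0$ otherwise; chirp periodic prefix, $\mathbf{S}_\ell=\boldsymbol{\Omega}_\ell\boldsymbol{\Pi}^\ell$ with $\boldsymbol{\Omega}_\ell=\mathrm{diag}(\omega_\ell[k])_{k=0}^{N-1}$, $\omega_\ell[k]=e^{j2\pi c_1(\ell^2-2\ell k)/N}$ for $k<\ell$ and $1$ otherwise ($c_1$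 a real parameter). $\mathrm{blkdiag}$ denotes the block-diagonal matrix with the listed blocks. *)

(* Defs.v *)
From HB Require Import structures.
From mathcomp Require Import all_boot all_order all_algebra.
From mathcomp Require Import complex.
From mathcomp Require Import reals trigo.

Set Implicit Arguments.
Unset Strict Implicit.
Unset Printing Implicit Defensive.

Import Order.TTheory GRing.Theory Num.Theory.
Local Open Scope ring_scope.
Local Open Scope sesquilinear_scope.
Local Open Scope complex_scope.

(* e^{j t} for real t *)
Definition expj (R : realType) (t : R) : R[i] := cos t +i* sin t.

Inductive guard_mode (R : Type) : Type :=
| CyclicPrefix
| ZeroPadding
| ChirpPeriodicPrefix of R. (* the parameter c_1 *)

(* The permutation matrix Pi, acting by (Pi x)[n] = x[(n - 1) mod N];
   [ord_pred] is the cyclic predecessor on 'I_N. *)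
Definition cyclic_shift (R : realType) (N : nat) : 'M[R[i]]_N :=
  \matrix_(n, k) (k == ord_pred n)%:R.

Lemma cyclic_shiftE (R : realType) (N : nat) (x : 'cV[R[i]]_N) (n : 'I_N) :
  (cyclic_shift R N *m x) n 0 = x (ord_pred n) 0.
Proof.
rewrite mxE (bigD1 (ord_pred n)) //= mxE eqxx mul1r big1 ?addr0 // => k nk.
by rewrite mxE (negbTE nk) mul0r.
Qed.

Definition zp_shift (R : realType) (N l : nat) : 'M[R[i]]_N :=
  \matrix_(n, k) (n == k + l :> nat)%N%:R.

Definition chirp_phase (R : realType) (N : nat) (c1 : R) (l k : nat) : R[i] :=
  if (k < l)%N
  then expj (2%:R * pi * c1 * (l%:R ^+ 2 - 2%:R * l%:R * k%:R) / N%:R)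
  else 1.

Definition chirp_mx (R : realType) (N : nat) (c1 : R) (l : nat) : 'M[R[i]]_N :=
  diag_mx (\row_k chirp_phase N c1 l k).

Definition delay_shift (R : realType) (N : nat) (g : guard_mode R) (l : nat) :
    'M[R[i]]_N :=
  match g with
  | CyclicPrefix => cyclic_shift R N ^+ l
  | ZeroPadding => zp_shift R N l
  | ChirpPeriodicPrefix c1 => chirp_mx N c1 l *m cyclic_shift R N ^+ l
  end.

Definition shifted_pilot (R : realType) (N : nat) (g : guard_mode R)
    (x : 'cV[R[i]]_N) (l : nat) : 'cV[R[i]]_N :=
  delay_shift N g l *m x.

(* Psi_{p,l} = D diag(z_{p,l}) Phi; [diag_mx] takes a row vector. *)
Definition pilot_block (R : realType) (N Q : nat) (D : 'M[R[i]]_N)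
    (Phi : 'M[R[i]]_(N, Q)) (g : guard_mode R) (x : 'cV[R[i]]_N) (l : nat) :
    'M[R[i]]_(N, Q) :=
  D *m diag_mx (shifted_pilot g x l)^T *m Phi.

(* Psi_p; the QL columns are indexed by 'I_(\sum_(l < L) Q), block by block. *)
Definition pilot_mx (R : realType) (N L Q : nat) (D : 'M[R[i]]_N)
    (Phi : 'M[R[i]]_(N, Q)) (g : guard_mode R) (x : 'cV[R[i]]_N) :
    'M[R[i]]_(N, \sum_(l < L) Q) :=
  \mxrow_(l < L) pilot_block D Phi g x l.

Definition gram_block (R : realType) (N Q : nat) (D : 'M[R[i]]_N)
    (Phi : 'M[R[i]]_(N, Q)) (g : guard_mode R) (x : 'cV[R[i]]_N) (i j : nat) :
    'M[R[i]]_Q :=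
  (pilot_block D Phi g x i)^t* *m pilot_block D Phi g x j.

Definition gram_mx (R : realType) (N L Q : nat) (D : 'M[R[i]]_N)
    (Phi : 'M[R[i]]_(N, Q)) (g : guard_mode R) (x : 'cV[R[i]]_N) :
    'M[R[i]]_(\sum_(l < L) Q) :=
  (pilot_mx L D Phi g x)^t* *m pilot_mx L D Phi g x.

(* zero pilot-pilot leakage *)
Definition ZPPL (R : realType) (N L Q : nat) (D : 'M[R[i]]_N)
    (Phi : 'M[R[i]]_(N, Q)) (g : guard_mode R) (x : 'cV[R[i]]_N) : Prop :=
  forall i j : 'I_L, i != j ->
    (pilot_block D Phi g x i)^t* *m pilot_block D Phi g x j = 0.

(* The estimator R_pp^-1 Psi_p^H r; [invmx A] is A when A is singular, so this
   is meaningful only when [gram_mx] is invertible. *)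
Definition estimator (R : realType) (N L Q : nat) (D : 'M[R[i]]_N)
    (Phi : 'M[R[i]]_(N, Q)) (g : guard_mode R) (x r : 'cV[R[i]]_N) :
    'cV[R[i]]_(\sum_(l < L) Q) :=
  invmx (gram_mx L D Phi g x) *m (pilot_mx L D Phi g x)^t* *m r.

(* Main.v *)
Require Import Defs.
From HB Require Import structures.
From mathcomp Require Import all_boot all_order all_algebra.
From mathcomp Require Import complex.
From mathcomp Require Import reals trigo.

Set Implicit Arguments.
Unset Strict Implicit.
Unset Printing Implicit Defensive.

Import Order.TTheory GRing.Theory Num.Theory.
Local Open Scope ring_scope.
Local Open Scope sesquilinear_scope.
Local Open Scope complex_scope.

(** The Gram matrix of a row of blocks is the block matrix whose (i, j) block is the product of
    block i, conjugate-transposed, with block j ([gram_mxrow]). ZPPL is exactly the vanishing of its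
    off-diagonal blocks, and a block-diagonal matrix with invertible blocks is inverted block by
    block ([invmx_mxdiag]), so the estimator decouples over the delays. For (ii), a block matrix
    with square diagonal blocks is diagonal iff its off-diagonal blocks vanish and its diagonal
    blocks are diagonal. Since D is unitary it cancels in each [gram_block] of equal indices, whose
    entries are then the weighted inner products of basis functions in the criterion
    ([gram_blockE]). *)

Lemma trmxC_mxrow (C : numClosedFieldType) (m n : nat) (p_ : 'I_n -> nat)
    (B_ : forall j, 'M[C]_(m, p_ j)) :
  (\mxrow_j B_ j)^t* = \mxcol_j (B_ j)^t*.
Proof. by apply/matrixP => i j; rewrite !mxE. Qed.

Lemma gram_mxrow (C : numClosedFieldType) (m n : nat) (p_ : 'I_n -> nat)
    (B_ : forall j, 'M[C]_(m, p_ j)) :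
  (\mxrow_j B_ j)^t* *m \mxrow_j B_ j = \mxblock_(i, j) ((B_ i)^t* *m B_ j).
Proof. by rewrite trmxC_mxrow mul_mxcol_mxrow. Qed.

Lemma mxblock_diag (V : nmodType) (n : nat) (p_ : 'I_n -> nat)
    (B_ : forall i j, 'M[V]_(p_ i, p_ j)) :
  (forall i j, i != j -> B_ i j = 0) ->
  \mxblock_(i, j) B_ i j = \mxdiag_i B_ i i.
Proof.
move=> B0; apply/eq_mxblock => i j.
(* [\mxdiag] casts its blocks with [conform_mx], since the sizes [p_ i] and [p_ j] agree only once i
   = j; the cast is then the identity. *)
by case: eqVneq => [<-|/B0//]; rewrite conform_mx_id.
Qed.

Lemma mul_mxdiag (C : pzSemiRingType) (n : nat) (p_ : 'I_n -> nat)
    (A_ B_ : forall i, 'M[C]_(p_ i)) :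
  \mxdiag_i A_ i *m \mxdiag_i B_ i = \mxdiag_i (A_ i *m B_ i).
Proof.
rewrite [X in _ *m X]/mxdiag mul_mxdiag_mxblock; apply/eq_mxblock => i j.
by case: eqVneq => [<-|_]; rewrite ?conform_mx_id ?mulmx0.
Qed.

(** Over a commutative ring a one-sided inverse of a square matrix is two-sided, so this identity
    yields both invertibility and the formula for the inverse. *)
Lemma mxdiag_mulV (C : comUnitRingType) (n : nat) (p_ : 'I_n -> nat)
    (A_ : forall i, 'M[C]_(p_ i)) :
  (forall i, A_ i \in unitmx) ->
  \mxdiag_i A_ i *m \mxdiag_i invmx (A_ i) = 1%:M.
Proof.
move=> uA; rewrite mul_mxdiag -mxdiagZ.
by apply: eq_mxdiag => i; rewrite mulmxV.
Qed.

Lemma mxdiag_unit (C : comUnitRingType) (n : nat) (p_ : 'I_n -> nat)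
    (A_ : forall i, 'M[C]_(p_ i)) :
  (forall i, A_ i \in unitmx) -> \mxdiag_i A_ i \in unitmx.
Proof. by move=> /mxdiag_mulV/mulmx1_unit[]. Qed.

Lemma invmx_mxdiag (C : comUnitRingType) (n : nat) (p_ : 'I_n -> nat)
    (A_ : forall i, 'M[C]_(p_ i)) :
  (forall i, A_ i \in unitmx) ->
  invmx (\mxdiag_i A_ i) = \mxdiag_i invmx (A_ i).
Proof.
(* Left multiplication by an invertible matrix is injective, so it suffices that both sides are
   right inverses. *)
move=> uA; apply: (can_inj (mulKmx (mxdiag_unit uA))).
by rewrite mxdiag_mulV// mulmxV// mxdiag_unit.
Qed.

Lemma gram_mx_mxblock (R : realType) (N L Q : nat) (D : 'M[R[i]]_N)
    (Phi : 'M[R[i]]_(N, Q)) (g : guard_mode R) (x : 'cV[R[i]]_N) :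
  gram_mx L D Phi g x = \mxblock_(i < L, j < L) gram_block D Phi g x i j.
Proof. exact: gram_mxrow. Qed.

(** The inner factor [D^t* *m D] is the identity; each diagonal entry then meets its own conjugate,
    leaving its squared modulus as a weight. *)
Lemma gram_unitary_diagE (C : numClosedFieldType) (n q : nat) (D : 'M[C]_n)
    (d : 'rV[C]_n) (B : 'M[C]_(n, q)) (a b : 'I_q) :
  D \is unitarymx ->
  ((D *m diag_mx d *m B)^t* *m (D *m diag_mx d *m B)) a b =
  \sum_k `|d 0 k| ^+ 2 * Num.conj (B k a) * B k b.
Proof.
move=> uD; rewrite -mulmxA trmx_mul map_mxM mulmxA mulmxKtV// mxE.
apply: eq_bigr => k _; rewrite !mul_diag_mx !mxE rmorphM normCKC.
by rewrite mulrACA mulrA.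
Qed.

Lemma gram_blockE (R : realType) (N Q : nat) (D : 'M[R[i]]_N)
    (Phi : 'M[R[i]]_(N, Q)) (g : guard_mode R) (x : 'cV[R[i]]_N) (l : nat)
    (a b : 'I_Q) :
  D \is unitarymx ->
  gram_block D Phi g x l l a b =
  \sum_(n < N) `|shifted_pilot g x l n 0| ^+ 2 * (Phi n a)^* * Phi n b.
Proof.
move=> uD; rewrite [LHS](gram_unitary_diagE _ _ _ _ uD).
by apply: eq_bigr => n _; rewrite mxE.
Qed.

Theorem mainTheorem6 (R : realType) (N L Q : nat)
    (hN : (0 < N)%N) (hL : (0 < L)%N) (hQ : (0 < Q)%N)
    (D : 'M[R[i]]_N) (hD : D \is unitarymx)
    (Phi : 'M[R[i]]_(N, Q)) (g : guard_mode R) (x : 'cV[R[i]]_N) :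
  (ZPPL L D Phi g x ->
     gram_mx L D Phi g x = \mxdiag_(l < L) gram_block D Phi g x l l /\
     ((forall l : 'I_L, gram_block D Phi g x l l \in unitmx) ->
        gram_mx L D Phi g x \in unitmx /\
        forall r : 'cV[R[i]]_N,
          estimator L D Phi g x r =
          \mxcol_(l < L) (invmx (gram_block D Phi g x l l)
                            *m (pilot_block D Phi g x l)^t* *m r))) /\
  (is_diag_mx (gram_mx L D Phi g x) <->
     ZPPL L D Phi g x /\
     forall (l : 'I_L) (a b : 'I_Q), a != b ->
       \sum_(n < N) `|shifted_pilot g x l n 0| ^+ 2 * (Phi n a)^* * Phi n b = 0).
Proof.
have diagE : ZPPL L D Phi g x ->
    gram_mx L D Phi g x = \mxdiag_(l < L) gram_block D Phi g x l l.
  by move=> zppl; rewrite gram_mx_mxblock mxblock_diag.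
split=> [zppl|].
  split=> [|uG]; first exact: diagE.
  rewrite diagE//; split=> [|r]; first exact: mxdiag_unit.
  (* The block-diagonal inverse acts on the stacked blocks of the conjugate-transposed [pilot_mx]
     one at a time. *)
  rewrite /estimator diagE// invmx_mxdiag// trmxC_mxrow mul_mxdiag_mxcol.
  by rewrite mxcol_mul.
(* The off-diagonal half of [is_diag_mxblockP] is ZPPL up to unfolding [gram_block]; the other half
   is read entrywise through [gram_blockE]. *)
rewrite gram_mx_mxblock; split=> [/is_diag_mxblockP[zppl diagG]|[zppl sum0]].
  split=> // l a b ab; rewrite -(gram_blockE Phi g x l a b hD).
  by have /is_diag_mxP := diagG l; apply.
apply/is_diag_mxblockP; split=> // l; apply/is_diag_mxP => a b ab.
by rewrite gram_blockE// sum0.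
Qed.
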